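(* For all integers $m\ge3$, \[ f(K_m,p)=\Omega_m\left(p^{-(2-\sqrt2)m+O(1)}\right); \] that is, there is an absolute constant $C$ such that for every $m\ge3$ there is a constant $\gamma_m>0$ depending only on $m$ with $f(K_m,p)\ge \gamma_m\, p^{-(2-\sqrt2)m+C}$ for all $p\in(0,1)$.
   Context: In the Subgraph Query Game with parameter $p\in(0,1)$, Builder plays alone on the random graph $G(\mathbb Z,p)$ with infinitely many vertices, whose edges are initially hidden. At each turn Builder queries (adaptively) one pair of vertices and is told whether it is an edge; equivalently, each queried edge is built successfully, independently, with probability $p$, and each pair may be queried at most once. For a graph $H$, $f(H,p)$ is the minimum, over all Builder strategies, of the number of turns needed to build a copy of $H$ with probability at least $\frac12$. *)

(* Defs.v *)
From HB Require Import structures.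
From mathcomp Require Import all_boot all_order all_algebra.
From mathcomp Require Import all_classical all_reals all_analysis.
Set Implicit Arguments.
Unset Strict Implicit.
Unset Printing Implicit Defensive.
Import Order.TTheory GRing.Theory Num.Theory.
Local Open Scope classical_set_scope.
Local Open Scope ring_scope.

Record sgraph := SGraph {
  vertex :> finType;
  adj : rel vertex;
  adj_sym : symmetric adj;
  adj_irr : irreflexive adj }.

Definition complete_rel (m : nat) : rel 'I_m := fun i j => i != j.

Lemma complete_rel_sym m : symmetric (@complete_rel m).
Proof. by move=> i j; rewrite /complete_rel eq_sym. Qed.

Lemma complete_rel_irr m : irreflexive (@complete_rel m).
Proof. by move=> i; rewrite /complete_rel eqxx. Qed.

Definition complete_graph (m : nat) : sgraph :=
  SGraph (@complete_rel_sym m) (@complete_rel_irr m).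

(* A pair of vertices of the board is an ordered pair of integers, read up to
   exchange of its components. *)
Definition same_pair (e e' : int * int) : bool :=
  (e == e') || (e == (e'.2, e'.1)).

(* [s a] is the pair queried on the turn following the answers [a], listed
   oldest first ([true] when the queried pair is an edge). The past queries of
   a deterministic Builder are determined by the past answers, so the answers
   are the whole history of the game. *)
Definition strategy := seq bool -> int * int.

Definition legal (s : strategy) : Prop :=
  forall a : seq bool,
    (s a).1 != (s a).2 /\
    forall i, (i < size a)%N -> ~~ same_pair (s (take i a)) (s a).

Definition built (s : strategy) (a : seq bool) (u v : int) : Prop :=
  exists2 i, (i < size a)%N &
    nth false a i /\ same_pair (s (take i a)) (u, v).

Definition has_copy (H : sgraph) (E : int -> int -> Prop) : Prop :=
  exists2 phi : H -> int, injective phi &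
    forall x y : H, adj x y -> E (phi x) (phi y).

(* As a legal strategy never repeats a pair, the answers to its first [N]
   queries of G(Z,p) are independent Bernoulli variables of parameter [p]. *)
Definition build_prob (R : realType) (p : R) (H : sgraph) (s : strategy)
    (N : nat) : R :=
  \sum_(a : N.-tuple bool | `[< has_copy H (built s a) >])
    \prod_(b <- a) (if b then p else 1 - p).

Definition buildable_in (R : realType) (p : R) (H : sgraph) (N : nat) : Prop :=
  exists2 s : strategy, legal s & 2^-1 <= build_prob p H s N.

(* The infimum of a set of natural numbers: it is a minimum unless the set is
   empty, in which case it is +oo. *)
Definition query_number (R : realType) (H : sgraph) (p : R) : \bar R :=
  ereal_inf [set N%:R%:E | N in [set N : nat | buildable_in p H N]].

Lemma query_number_min (R : realType) (H : sgraph) (p : R) :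
  (exists N, buildable_in p H N) ->
  exists2 N : nat, buildable_in p H N & query_number H p = N%:R%:E.
Proof.
move=> exN; have exb : exists N, `[< buildable_in p H N >].
  by have [N hN] := exN; exists N; apply/asboolP.
have [N /asboolP hN minN] := ex_minnP exb.
exists N => //; apply/eqP; rewrite eq_le; apply/andP; split.
  by apply: ereal_inf_lbound; exists N.
apply: le_ereal_inf_tmp => _ [M /= hM <-].
by rewrite lee_fin ler_nat; apply/minN/asboolP.
Qed.

(* Main.v *)
Require Import Defs.
From HB Require Import structures.
From mathcomp Require Import all_boot all_order all_algebra.
From mathcomp Require Import all_classical all_reals all_analysis.
From mathcomp Require Import perm zify ring lra.
Set Implicit Arguments.
Unset Strict Implicit.
Unset Printing Implicit Defensive.
Import Order.TTheory GRing.Theory Num.Theory.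
Local Open Scope ring_scope.

(* Fix a copy of K_m built within N queries and let tau(u, v) be the time at
   which the edge uv is queried. Among the matchings of k edges of K_m, take one
   minimising the sum of 2 ^ tau, and cover each unmatched vertex by its first
   edge. Given the query times of these at most m - k covering edges, for which
   there are N ^ (m - k) choices, an edge queried after both its ends have been
   covered joins two known vertices, so it costs a factor p. Minimality makes
   every edge meeting at most one matched pair late in this sense, as well as two
   of the four edges between any two matched pairs. Hence
     P(K_m is built) <= c_m N ^ (m - k) p ^ (binom(m, 2) - k (k - 1)),
   and k close to (1 - 1 / sqrt 2) m gives the exponent. *)

(** * Probability of answers forced by the history *)

Lemma sum_tuple_cons (R : pzSemiRingType) (T : finType) (n : nat)
    (P : pred (seq T)) (F : seq T -> R) :
  \sum_(a : n.+1.-tuple T | P a) F a =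
  \sum_(b : T) \sum_(a : n.-tuple T | P (b :: a)) F (b :: a).
Proof.
rewrite pair_big_dep /= (reindex (fun x : T * n.-tuple T => [tuple of x.1 :: x.2])) //=.
exists (fun a : n.+1.-tuple T => (thead a, [tuple of behead a])) => [[b a] _|a _] /=.
  by congr pair; apply: val_inj.
by rewrite [RHS]tuple_eta.
Qed.

(* [c h] means that, after the answers [h], the next answer must be [true]. *)
Fixpoint obeys (c : pred (seq bool)) (h a : seq bool) : bool :=
  if a is b :: a' then (c h ==> b) && obeys c (rcons h b) a' else true.

Fixpoint forced (c : pred (seq bool)) (h a : seq bool) : nat :=
  if a is b :: a' then (c h + forced c (rcons h b) a')%N else 0%N.

Lemma obeysP (c : pred (seq bool)) (h a : seq bool) :
  (forall i, (i < size a)%N -> c (h ++ take i a) -> nth false a i) ->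
  obeys c h a.
Proof.
elim: a h => [//|b a IH] h H /=; apply/andP; split.
  by apply/implyP => ch; apply: (H 0%N) => //=; rewrite cats0.
apply: IH => i ia; rewrite cat_rcons => hc.
exact: (H i.+1).
Qed.

Lemma forcedE (c : pred (seq bool)) (h a : seq bool) :
  forced c h a = (\sum_(i < size a) c (h ++ take i a))%N.
Proof.
elim: a h => [|b a IH] h /=; first by rewrite big_ord0.
rewrite big_ord_recl /= cats0 IH; congr addn; apply: eq_bigr => i _.
by rewrite cat_rcons.
Qed.

(** Induction on [N]. Where [c h] holds, only the answer [true] survives, at the price of a factor
    [p], and a positive [L] drops by one; elsewhere the bound [p ^+ L] is averaged over both
    answers. *)
Lemma prob_forced_le (R : realType) (p : R) (c : pred (seq bool)) (N L : nat)
    (h : seq bool) :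
  0 < p -> p < 1 ->
  \sum_(a : N.-tuple bool | obeys c h a && (L <= forced c h a)%N)
    \prod_(b <- a) (if b then p else 1 - p) <= p ^+ L.
Proof.
move=> p0 p1; elim: N L h => [|N IH] L h.
  case: L => [|L].
    by rewrite (big_pred1 [tuple]) ?big_nil // => -[[|//] ?]; apply/esym/eqP/val_inj.
  by rewrite big_pred0 ?exprn_ge0 ?ltW // => a; rewrite tuple0.
rewrite (@sum_tuple_cons R bool N (fun a => obeys c h a && (L <= forced c h a)%N)
  (fun a => \prod_(b <- a) (if b then p else 1 - p))).
rewrite big_bool /=.
under eq_bigr do rewrite big_cons.
under [X in _ + X]eq_bigr do rewrite big_cons.
rewrite -!mulr_sumr; case: (c h) => /=.
  rewrite big_pred0_eq mulr0 addr0.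
  case: L => [|L].
    rewrite expr0 mulr_ile1 ?(ltW p0) ?(ltW p1) //.
      by apply: sumr_ge0 => a _; apply: prodr_ge0 => -[] _; rewrite ?subr_ge0 ltW.
    exact: (IH 0%N (rcons h true)).
  by rewrite exprS ler_pM2l // IH.
rewrite (_ : p ^+ L = p * p ^+ L + (1 - p) * p ^+ L); last by ring.
by rewrite lerD // ler_wpM2l ?subr_ge0 ?IH // ltW.
Qed.

(** * Matchings of minimal weight *)

(** An injective [f] encodes a matching whose edge [i] joins [f (i, false)] to [f (i, true)]. *)
Definition pair_time (m k : nat) (tau : 'I_m -> 'I_m -> nat)
    (f : 'I_k * bool -> 'I_m) (i : 'I_k) : nat :=
  tau (f (i, false)) (f (i, true)).

Lemma pair_timeE (m k : nat) (tau : 'I_m -> 'I_m -> nat)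
    (tauC : forall u v, tau u v = tau v u) (f : 'I_k * bool -> 'I_m) i b :
  tau (f (i, b)) (f (i, ~~ b)) = pair_time tau f i.
Proof. by case: b => //; rewrite tauC. Qed.

(* Every alternative replaces the edges of one or two pairs by earlier ones,
   and powers of two make the latest edge dominate. *)
Lemma earliest_matching (m k : nat) (tau : 'I_m -> 'I_m -> nat)
    (tauC : forall u v, tau u v = tau v u) : (k.*2 <= m)%N ->
  exists f : 'I_k * bool -> 'I_m,
  [/\ injective f,
     forall i b x, (forall q, f q != x) -> (pair_time tau f i <= tau x (f (i, b)))%N &
     forall i j e, i != j -> exists b : bool,
       (maxn (pair_time tau f i) (pair_time tau f j) <= tau (f (i, b)) (f (j, b (+) e)))%N].
Proof.
move=> km.
pose wt (f : {ffun 'I_k * bool -> 'I_m}) := (\sum_i 2 ^ pair_time tau f i)%N.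
have cardD : #|{: 'I_k * bool}| = k.*2 by rewrite card_prod card_ord card_bool muln2.
have f0P (q : 'I_k * bool) : (enum_rank q < m)%N.
  by rewrite (leq_trans (ltn_ord _)) // cardD.
pose f0 := [ffun q => Ordinal (f0P q)].
have inj_f0 : injectiveb f0.
  apply/injectiveP => q r; rewrite !ffunE => /(congr1 val) /= /val_inj.
  exact: enum_rank_inj.
have [f /injectiveP inj_f fmin] :=
  @arg_minnP _ f0 (fun f : {ffun 'I_k * bool -> 'I_m} => injectiveb f) wt inj_f0.
exists f; split=> //.
  move=> i b x fx; rewrite leqNgt; apply/negP => lt_x.
  (* Pair [i] trades its end [f (i, ~~ b)] for the unmatched [x], which would lower the weight. *)
  pose g := [ffun q => if q == (i, ~~ b) then x else f q].
  have inj_g : injectiveb g.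
    apply/injectiveP => q r; rewrite !ffunE.
    case: eqP => [->|qn]; case: eqP => [->|rn] //.
    - by move=> E; have := fx r; rewrite -E eqxx.
    - by move=> E; have := fx q; rewrite E eqxx.
    - by move/inj_f.
  have := fmin g inj_g; apply/negP; rewrite -ltnNge /wt.
  rewrite (bigD1 i) //= [X in (_ < X)%N](bigD1 i) //= -addSn leq_add //.
    rewrite -(pair_timeE tauC g i b) ltn_exp2l // !ffunE eqxx tauC.
    by rewrite xpair_eqE eqxx /= (_ : b == ~~ b = false) //; case: (b).
  apply: leq_sum => j /negPf ji.
  by rewrite /pair_time !ffunE !xpair_eqE ji.
move=> i j e ij.
(* The transposition rematches the two pairs along the edges from [f (i, b)] to [f (j, b (+) e)],
   for both values of [b]. *)
pose g := [ffun x => f (tperm (i, ~~ e) (j, false) x)].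
case: (leqP (maxn (pair_time tau f i) (pair_time tau f j))
            (tau (f (i, true)) (f (j, true (+) e)))).
  by move=> h; exists true.
case: (leqP (maxn (pair_time tau f i) (pair_time tau f j))
            (tau (f (i, false)) (f (j, false (+) e)))).
  by move=> h; exists false.
move=> l1 l2; exfalso.
have inj_g : injectiveb g.
  by apply/injectiveP => x y; rewrite !ffunE => /inj_f /perm_inj.
have := fmin g inj_g; apply/negP; rewrite -ltnNge /wt.
have ji : j != i by rewrite eq_sym.
rewrite (bigD1 i) //= (bigD1 j) //= [X in (_ < X)%N](bigD1 i) //=.
rewrite [X in (_ < _ + X)%N](bigD1 j) //=.
have -> : (\sum_(l < k | (l != i) && (l != j)) 2 ^ pair_time tau g l =
           \sum_(l < k | (l != i) && (l != j)) 2 ^ pair_time tau f l)%N.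
  apply: eq_bigr => l /andP[li lj].
  by rewrite /pair_time !ffunE !tpermD // xpair_eqE negb_and
    1?[i == l]eq_sym 1?[j == l]eq_sym ?li ?lj.
rewrite !addnA ltn_add2r.
have gi : pair_time tau g i = tau (f (i, e)) (f (j, false)).
  rewrite -(pair_timeE tauC g i e) !ffunE tpermL tpermD // xpair_eqE ?(negPf ji) // eqxx /=.
  by case: (e).
have gj : pair_time tau g j = tau (f (i, ~~ e)) (f (j, true)).
  rewrite -(pair_timeE tauC g j false) /= !ffunE tpermR tpermD // xpair_eqE ?(negPf ij) //.
  by rewrite eqxx.
have [lgi lgj] : (pair_time tau g i < maxn (pair_time tau f i) (pair_time tau f j))%N /\
   (pair_time tau g j < maxn (pair_time tau f i) (pair_time tau f j))%N.
  by rewrite gi gj; case: (e) l1 l2 => /= l1 l2; split.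
(* Two powers with exponents below the maximum add up to at most the larger old term, and the other
   old term is positive. *)
have pow2 n n' : (n < n')%N -> (2 ^ n * 2 <= 2 ^ n')%N.
  by move=> nn; rewrite -expnSr leq_exp2l.
have pos n : (0 < 2 ^ n)%N by rewrite expn_gt0.
move: (pow2 _ _ lgi) (pow2 _ _ lgj) (pos (pair_time tau f i)) (pos (pair_time tau f j)).
case: (leqP (pair_time tau f i) (pair_time tau f j)) => _;
  move: (2 ^ pair_time tau f i)%N (2 ^ pair_time tau f j)%N (2 ^ pair_time tau g i)%N
        (2 ^ pair_time tau g j)%N => *; lia.
Qed.

(** * Covering the vertices by few edges *)

Lemma factor_ord (T U : finType) (g : T -> U) (n : nat) :
  (#|codom g| <= n)%N ->
  exists slot : T -> 'I_n, forall u v, slot u = slot v -> g u = g v.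
Proof.
move=> gn; have gP u : g u \in enum (codom g) by rewrite mem_enum codom_f.
have lt_n u : (index (g u) (enum (codom g)) < n)%N.
  by rewrite (leq_trans _ gn) // cardE index_mem.
exists (fun u => Ordinal (lt_n u)) => u v /(congr1 val) /= E.
by rewrite -(nth_index (g u) (gP u)) E nth_index.
Qed.

Lemma card_offdiag (T : finType) :
  #|[set e : T * T | e.1 != e.2]| = (#|T| * #|T|.-1)%N.
Proof.
have -> : [set e : T * T | e.1 != e.2] = ~: [set (x, x) | x in T].
  apply/setP => -[x y]; rewrite !inE /=; congr (~~ _).
  apply/eqP/imsetP => [->|[z _ [-> ->]] //]; by exists y.
rewrite cardsCs finset.setCK card_imset => [|x y [] //].
by rewrite card_prod -subn1 mulnBr muln1.
Qed.

(* [v] is covered by the edge from [v] to [w v]; vertices of the same slot share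
   their covering edge. *)
Lemma edge_cover (m k : nat) (tau : 'I_m -> 'I_m -> nat) :
  (1 < m)%N -> (k.*2 <= m)%N -> (forall u v, tau u v = tau v u) ->
  exists (slot : 'I_m -> 'I_(m - k)) (w : 'I_m -> 'I_m),
  [/\ forall v, w v != v,
     forall u v, slot u = slot v -> u = v \/ w u = v /\ w v = u &
     (m * m.-1 <= #|[set e : 'I_m * 'I_m | (e.1 != e.2) &&
        (maxn (tau e.1 (w e.1)) (tau e.2 (w e.2)) <= tau e.1 e.2)]|
        + (k * k.-1).*2)%N].
Proof.
move=> m1 km tauC.
have [f [inj_f single_f swap_f]] := earliest_matching tauC km.
pose loc v := [pick q | f q == v].
have locP v : if loc v is Some q then f q = v else forall q, f q != v.
  by rewrite /loc; case: pickP => [q /eqP //|h q]; rewrite h.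
have locf q : loc (f q) = Some q.
  by have := locP (f q); case: (loc (f q)) => [r /inj_f -> //|/(_ q)]; rewrite eqxx.
have otherP (v : 'I_m) : exists y, y != v.
  have m0 : (0 < m)%N by lia.
  case: (eqVneq v (Ordinal m0)) => [->|h]; last by exists (Ordinal m0); rewrite eq_sym.
  by exists (Ordinal m1).
pose w v := if loc v is Some q then f (q.1, ~~ q.2)
            else [arg min_(y < xchoose (otherP v) | y != v) tau v y].
have wmin v y : loc v = None -> y != v -> (tau v (w v) <= tau v y)%N.
  move=> lv yv; rewrite /w lv; case: arg_minnP => [|z _]; last exact.
  exact: (xchooseP (otherP v)).
(* Both ends of pair [i] go to [f (i, false)], so [g] misses the [k] values [f (i, true)]. *)
pose g v := if loc v is Some q then f (q.1, false) else v.
have cg : (#|codom g| <= m - k)%N.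
  have inj_ft : injective (fun i => f (i, true)) by move=> i j /inj_f [].
  have cC := cardC (mem (codom g)); rewrite card_ord in cC.
  have := fintype.card_image inj_ft 'I_k; rewrite card_ord => ck.
  apply: (@leq_trans (m - #|[predC mem (codom g)]|)).
    by rewrite -[X in (_ <= X - _)%N]cC addnK.
  rewrite leq_sub2l // -{1}ck subset_leq_card //.
  apply/fintype.subsetP => _ /fintype.imageP[i _ ->]; rewrite !inE.
  apply/codomP => -[x]; rewrite /g.
  have := locP x; case E: (loc x) => [q|] _; first by move/inj_f.
  by move=> fx; move: E; rewrite -fx locf.
have [slot slotP] := factor_ord cg.
exists slot, w; split.
- move=> v; rewrite /w; have := locP v; case: (loc v) => [[i b] /= <-|_].
    by apply/eqP => /inj_f [] /eqP; rewrite eq_sym -addTb -negb_add; case: (b).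
  by case: arg_minnP => [|z] //; exact: (xchooseP (otherP v)).
- move=> u v /slotP; rewrite /g /w.
  have := locP u; have := locP v.
  case: (loc v) => [[j b']|] /= fv; case: (loc u) => [[i b]|] /= fu.
  + move=> /inj_f [ij]; subst j; rewrite -fu -fv.
    by case: b b' {fu fv} => [] [] /=; [left|right|right|left].
  + by move=> gu; have := fu (j, false); rewrite gu eqxx.
  + by move=> gu; have := fv (i, false); rewrite gu eqxx.
  + by left.
rewrite -[X in (X * X.-1)%N](card_ord m) -card_offdiag.
set good := [set e | _ && _]; set off := [set e | _].
rewrite -(cardsID good off) leq_add //.
  by rewrite subset_leq_card // finset.subsetIr.
(* By [swap_f], for [i != j] and each [e] at most one [b] fails [late]; [F] selects that [b] if
   there is one. The pairs outside [good] thus lie in the image of [D], which has [2 k (k - 1)]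
   elements. *)
pose late i j e b := (maxn (pair_time tau f i) (pair_time tau f j)
  <= tau (f (i, b)) (f (j, b (+) e)))%N.
pose F (d : 'I_k * 'I_k * bool) := let b := ~~ late d.1.1 d.1.2 d.2 true in
  (f (d.1.1, b), f (d.1.2, b (+) d.2)).
pose D := [set d : 'I_k * 'I_k * bool | d.1.1 != d.1.2].
have -> : ((k * k.-1).*2 = #|D|)%N.
  have -> : D = finset.setX [set e : 'I_k * 'I_k | e.1 != e.2] [set: bool].
    by apply/setP => -[[i j] b]; rewrite !inE andbT.
  by rewrite cardsX card_offdiag cardsT card_bool card_ord muln2.
apply: leq_trans (leq_imset_card F D); apply: subset_leq_card.
have cov i b : tau (f (i, b)) (w (f (i, b))) = pair_time tau f i.
  by rewrite /w locf /= pair_timeE.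
have covf i b x : loc x = None -> (pair_time tau f i <= tau x (f (i, b)))%N.
  by move=> lx; apply: single_f => q; have := locP x; rewrite lx.
apply/fintype.subsetP => -[u v]; rewrite !inE /= => /andP[+ uv]; rewrite uv /= ssrnat.geq_max.
have := locP u; have := locP v.
case Ev: (loc v) => [[j b']|] /= fv; last first.
  case Eu: (loc u) => [[i b]|] /= fu; last by rewrite wmin 1?eq_sym // [tau u v]tauC wmin.
  by rewrite -fu cov [tau _ v]tauC covf // wmin // fu.
case Eu: (loc u) => [[i b]|] /= fu; last first.
  by rewrite -fv cov covf // wmin // fv eq_sym.
rewrite -fu -fv !cov -ssrnat.geq_max => bad.
(* The edge of a matched pair is queried exactly at the time of the pair, so it is not bad. *)
have ij : i != j.
  apply: contraNneq bad => ij; subst j.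
  have -> : b' = ~~ b by move: uv; rewrite -fu -fv; clear; case: b b' => [] []; rewrite ?eqxx.
  by rewrite (pair_timeE tauC) maxnn.
apply/imsetP; exists ((i, j), b (+) b'); rewrite ?inE //= /F /=.
suff -> : ~~ late i j (b (+) b') true = b by rewrite addbA addbb addFb.
have badl : ~~ late i j (b (+) b') b by rewrite /late addbA addbb addFb.
have [c lc] : exists c, late i j (b (+) b') c := swap_f i j (b (+) b') ij.
move: (b (+) b') lc badl => e lc badl.
clear -lc badl; move: lc badl.
by case: c b => [] [] /= lc; rewrite ?lc.
Qed.

(** * Signatures of copies *)

Lemma same_pair_swap (e : int * int) (x y : int) :
  same_pair e (x, y) = same_pair e (y, x).
Proof. by rewrite /same_pair /= orbC. Qed.

Lemma same_pair_join (e1 e2 e : int * int) :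
  same_pair e1 e -> same_pair e2 e -> same_pair e1 e2.
Proof.
case: e1 e2 e => [x1 y1] [x2 y2] [x y]; rewrite /same_pair /= !xpair_eqE.
by move=> /orP[] /andP[/eqP -> /eqP ->] /orP[] /andP[/eqP -> /eqP ->];
  rewrite !eqxx ?orbT.
Qed.

Lemma query_time_uniq (s : strategy) (a : seq bool) (i j : nat) (e : int * int) :
  legal s -> (i < size a)%N -> (j < size a)%N ->
  same_pair (s (take i a)) e -> same_pair (s (take j a)) e -> i = j.
Proof.
move=> ls; wlog ij : i j / (i < j)%N.
  by move=> H; case: (ltngtP i j) => // ij *; [|apply/esym]; apply: H.
move=> ia ja si sj; have [_ /(_ i)] := ls (take j a).
rewrite size_take ja => /(_ ij); rewrite take_takel 1?ltnW //.
by rewrite (same_pair_join si sj).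
Qed.

(* A signature [sg] of a copy assigns to each vertex [v] a query [sg.2 j],
   shared by the vertices of the same slot [j], and which of the two ends of
   that query is [v]. *)
Definition signature (m n N : nat) : Type :=
  ({ffun 'I_m -> 'I_n * bool} * {ffun 'I_n -> 'I_N})%type.

Definition cover_time (m n N : nat) (sg : signature m n N) (v : 'I_m) : nat := sg.2 (sg.1 v).1.

(** The value is meaningful once [cover_time sg v <= size h], as [determined] requires; at equality
    the covering query is the pending query [s h]. *)
Definition placed (m n N : nat) (s : strategy) (sg : signature m n N)
    (h : seq bool) (v : 'I_m) : int :=
  let q := s (take (cover_time sg v) h) in if (sg.1 v).2 then q.1 else q.2.

(** This depends on [sg] and the past answers but not on the copy, so [prob_forced_le] applies for
    each fixed [sg]. The non-strict inequality lets covering queries count too. *)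
Definition determined (m n N : nat) (s : strategy) (sg : signature m n N)
    (h : seq bool) : bool :=
  [exists e : 'I_m * 'I_m, [&& e.1 != e.2,
     (maxn (cover_time sg e.1) (cover_time sg e.2) <= size h)%N &
     same_pair (s h) (placed s sg h e.1, placed s sg h e.2)]].

(** The signature records times and orientations of the covering edges of the copy. Every query it
    determines is an edge of the copy, hence answered [true], and [edge_cover] provides enough of
    them. *)
Lemma copy_signature (m k N : nat) (s : strategy) (a : N.-tuple bool) :
  (1 < m)%N -> (k.*2 <= m)%N -> legal s ->
  has_copy (complete_graph m) (built s a) ->
  exists sg : signature m (m - k) N, obeys (determined s sg) [::] a &&
    ('C(m, 2) - k * k.-1 <= forced (determined s sg) [::] a)%N.
Proof.
move=> m1 km ls [phi inj_phi copy].
have built_time (u v : 'I_m) : u != v -> exists i : 'I_N,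
    nth false a i /\ same_pair (s (take i a)) (phi u, phi v).
  move=> uv; have [i ia ?] := copy u v uv.
  by rewrite size_tuple in ia; exists (Ordinal ia).
have [i0 _] := built_time (Ordinal (ltnW m1)) (Ordinal m1) isT.
have [tau0 tau0P] : {tau : 'I_m * 'I_m -> 'I_N & forall e, e.1 != e.2 ->
    nth false a (tau e) /\ same_pair (s (take (tau e) a)) (phi e.1, phi e.2)}.
  apply: (@boolp.choice _ _ (fun e (i : 'I_N) => e.1 != e.2 ->
    nth false a i /\ same_pair (s (take i a)) (phi e.1, phi e.2))) => -[u v] /=.
  by have [->|/built_time [i ?]] := eqVneq u v; [exists i0|exists i].
pose tau u v := tau0 (u, v).
have tauP u v : u != v ->
    nth false a (tau u v) /\ same_pair (s (take (tau u v) a)) (phi u, phi v).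
  exact: (tau0P (u, v)).
have tau_uniq (i : nat) u v : u != v -> (i < N)%N ->
    same_pair (s (take i a)) (phi u, phi v) -> i = tau u v.
  move=> /tauP[_ st] iN si.
  by apply: (query_time_uniq ls _ _ si st); rewrite size_tuple.
have tauC u v : tau u v = tau v u.
  have [->//|uv] := eqVneq u v; apply: val_inj; apply: tau_uniq => //=.
    by rewrite eq_sym.
  by rewrite same_pair_swap; have [] := tauP u v uv.
have [slot [w [wP slotP cardP]]] :=
  @edge_cover m k (fun u v => tau u v) m1 km (fun u v => congr1 val (tauC u v)).
(* Vertices of one slot share their covering edge, so any of them gives its time; [i0] fills the
   empty slots. *)
pose T : {ffun 'I_(m - k) -> 'I_N} :=
  [ffun j => if [pick v | slot v == j] is Some v then tau v (w v) else i0].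
pose bit v := phi v == (s (take (tau v (w v)) a)).1.
pose sg : signature m (m - k) N := ([ffun v => (slot v, bit v)], T).
have coverE v : cover_time sg v = tau v (w v).
  rewrite /cover_time !ffunE /=; case: pickP => [u /eqP uv|/(_ v)]; last by rewrite eqxx.
  by case: (slotP _ _ uv) => [->//|[-> <-]]; rewrite tauC.
have placedE i v : (cover_time sg v <= i)%N -> placed s sg (take i a) v = phi v.
  move=> ci; rewrite /placed take_takel // coverE ffunE /= /bit.
  have [_] := tauP v (w v) ltac:(by rewrite eq_sym).
  case: (s _) => x y; rewrite /same_pair /= !xpair_eqE.
  by have [->|nx] := eqVneq (phi v) x => //= /andP[_ /eqP].
exists sg; apply/andP; split.
  apply: obeysP => i; rewrite size_tuple cat0s => iN /existsP[[u v] /= /and3P[uv]].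
  have -> : size (take i a) = i by rewrite size_takel // size_tuple ltnW.
  rewrite ssrnat.geq_max => /andP[cu cv].
  rewrite !placedE // => /(tau_uniq _ _ _ uv iN) ->.
  by have [] := tauP u v uv.
rewrite forcedE size_tuple.
rewrite (_ : (\sum_(i < N) _)%N = #|[set i : 'I_N | determined s sg (take i a)]|); last first.
  by rewrite -sum1_card [RHS]big_mkcond /=; apply: eq_bigr => i _; rewrite inE;
    case: determined.
set good := [set e | _] in cardP; set det := [set i | _].
(* The bit separates the two orientations of an edge, so each determined turn accounts for at most
   two elements of [good]. *)
pose F (e : 'I_m * 'I_m) := (tau e.1 e.2, (e.1 < e.2)%N).
suff : (#|good| <= #|det|.*2)%N.
  have := bin_ffact m 2; rewrite ffactnS ffactn1 (_ : 2`! = 2)%N // => E.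
  move: cardP; rewrite -E; lia.
have injF : {in good &, injective F}.
  move=> [u v] [u' v']; rewrite !inE /F /= => /andP[uv _] /andP[uv' _] [tt lt].
  have [_ sp] := tauP u v uv; have [_ sp'] := tauP u' v' uv'.
  have : same_pair (phi u, phi v) (phi u', phi v').
    rewrite -tt in sp'; move: sp sp'.
    case: (s _) => x y; rewrite /same_pair /= !xpair_eqE.
    by move=> /orP[] /andP[/eqP -> /eqP ->] /orP[] /andP[/eqP -> /eqP ->]; rewrite !eqxx ?orbT.
  rewrite /same_pair /= !xpair_eqE !(inj_eq inj_phi).
  case/orP => /andP[/eqP uu /eqP vv]; first by rewrite uu vv.
  move: lt uv; rewrite uu vv -val_eqE /=; lia.
rewrite -(card_in_imset injF) -muln2 -card_bool -[#|{: bool}|]cardsT -cardsX.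
apply: subset_leq_card; apply/fintype.subsetP => _ /imsetP[[u v] + ->].
rewrite !inE andbT /= => /andP[uv le_uv].
have sz : size (take (tau u v) a) = tau u v by rewrite size_takel // size_tuple ltnW.
apply/existsP; exists (u, v); rewrite /= uv sz !coverE le_uv /=.
move: le_uv; rewrite ssrnat.geq_max -!coverE => /andP[cu cv].
by rewrite !placedE //; have [] := tauP u v uv.
Qed.

(** * Union bound and choice of [k] *)

(** Union bound: the natural number factor counts the signatures, and [prob_forced_le] bounds the
    contribution of each. *)
Lemma build_prob_complete_le (R : realType) (p : R) (m k N : nat) (s : strategy) :
  0 < p -> p < 1 -> (1 < m)%N -> (k.*2 <= m)%N -> legal s ->
  build_prob p (complete_graph m) s N <=
  (((m - k) * 2) ^ m * N ^ (m - k))%:R * p ^+ ('C(m, 2) - k * k.-1).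
Proof.
move=> p0 p1 m1 km ls; rewrite /build_prob.
pose L := ('C(m, 2) - k * k.-1)%N.
pose P (sg : signature m (m - k) N) (a : seq bool) :=
  obeys (determined s sg) [::] a && (L <= forced (determined s sg) [::] a)%N.
pose wt (a : seq bool) : R := \prod_(b <- a) (if b then p else 1 - p).
have wt0 a : 0 <= wt a by apply: prodr_ge0 => -[] _; rewrite ?subr_ge0 ltW.
apply: (@le_trans _ _ (\sum_(a : N.-tuple bool) \sum_(sg | P sg a) wt a)).
  rewrite big_mkcond; apply: ler_sum => a _; case: asboolP => [cp|_]; last exact: sumr_ge0.
  have [sg hsg] := copy_signature m1 km ls cp.
  by rewrite (bigD1 sg) //= lerDl sumr_ge0.
rewrite (exchange_big_dep xpredT) //=.
apply: (@le_trans _ _ (\sum_(sg : signature m (m - k) N) p ^+ L)).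
  by apply: ler_sum => sg _; apply: prob_forced_le.
rewrite sumr_const mulr_natl card_prod !card_ffun card_prod !card_ord card_bool.
by rewrite lexx.
Qed.

(* With [x := m - k] close to [m / sqrt 2], the exponent per free query
   [('C(m, 2) - k (k - 1)) / x] is [2 m - x - m ^ 2 / (2 x)] up to [O(1)]. *)
Lemma matching_size (R : realType) (m : nat) :
  exists2 k : nat, (k.*2 <= m)%N &
    ((2 - Num.sqrt 2) * m%:R - 2) * (m - k)%:R <=
    ('C(m, 2) - k * k.-1)%:R :> R.
Proof.
set r := Num.sqrt 2 : R.
have r2 : r ^+ 2 = 2 by rewrite sqr_sqrtr.
have r0 : 0 <= r by exact: sqrtr_ge0.
have rl : 1 < r by nra.
have ru : r < 2 by nra.
have y0 : 0 <= (1 - r / 2) * m%:R :> R by rewrite mulr_ge0 ?subr_ge0 //; lra.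
(* Without the rounding, [m - k] would be [m / sqrt 2]. *)
set k := Num.truncn ((1 - r / 2) * m%:R).
have /andP[kl ku] := truncn_itv y0; rewrite -/k in kl ku.
have m0 : 0 <= m%:R :> R by [].
have k0 : 0 <= k%:R :> R by [].
have k2m : (k.*2 <= m)%N.
  have : 0 <= (r - 1) * m%:R by rewrite mulr_ge0 // subr_ge0 ltW.
  by rewrite -(ler_nat R) -muln2 natrM; lra.
have km : (k <= m)%N by rewrite (leq_trans _ k2m) // -addnn leq_addr.
exists k => //; rewrite natrB //.
have {}ku : (1 - r / 2) * m%:R < k%:R + 1 by rewrite natr1.
have kk : ((k * k.-1)%:R : R) = k%:R * (k%:R - 1).
  by case: (k) => [|n]; rewrite ?mul0r // natrM /= -natr1 addrK.
have mm : 2 * ('C(m, 2)%:R : R) = m%:R * (m%:R - 1).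
  rewrite -natrM mulnC; have := bin_ffact m 2; rewrite (_ : 2`! = 2)%N // => ->.
  by rewrite ffactnS ffactn1; case: (m) => [|n]; rewrite ?mul0r // natrM /= -natr1 addrK.
have : ('C(m, 2)%:R - (k * k.-1)%:R : R) <= ('C(m, 2) - k * k.-1)%:R.
  by rewrite lerBlDr -natrD ler_nat; lia.
apply: le_trans; rewrite kk.
suff : 2 * (((2 - r) * m%:R - 2) * (m%:R - k%:R)) <=
       m%:R * (m%:R - 1) - 2 * (k%:R * (k%:R - 1)) :> R by rewrite -mm; lra.
move: kl ku k0 m0; move: (m%:R : R) (k%:R : R) => M K kl ku k0 m0.
(* With [d] the rounding error and [r ^+ 2 = 2], the right side exceeds the left by
   [M + r * M + 2 * (d * (1 - d))]. *)
have {kl ku} [d d01 ->] : exists2 d, 0 <= d <= 1 & K = (1 - r / 2) * M - d.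
  by exists ((1 - r / 2) * M - K); [apply/andP; split|]; lra.
rewrite -subr_ge0 [leRHS](_ : _ =
  M + r * M + 2 * (d * (1 - d)) + (r ^+ 2 - 2) * (M ^+ 2 / 2)); last by field.
have {d01}/andP[d0 d1] := d01.
by rewrite r2 subrr mul0r addr0 !addr_ge0 ?mulr_ge0 ?subr_ge0.
Qed.

Theorem corollary14 (R : realType) :
  exists C : R, forall m : nat, (3 <= m)%N ->
    exists2 gamma : R, 0 < gamma &
      forall p : R, 0 < p -> p < 1 ->
        ((gamma * p `^ (- (2 - Num.sqrt 2) * m%:R + C))%:E
           <= query_number (complete_graph m) p)%E.
Proof.
(* The constant 2 cancels the [- 2] of [matching_size]. *)
exists 2 => m m3; have [k k2m kP] := matching_size R m.
set x := (m - k)%N in kP.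
have x0 : (0 < x)%N by rewrite /x; lia.
(* The factor 4 brings the final probability bound down to [1 / 4], below the required [1 / 2]. *)
pose A : R := (4 * (x * 2) ^ m)%:R.
have A1 : 4 <= A by rewrite /A natrM ler_peMr // ler1n expn_gt0; lia.
exists A^-1 => [|p p0 p1]; first by rewrite invr_gt0; lra.
apply: le_ereal_inf_tmp => _ [N /= [s ls half] <-]; rewrite lee_fin leNgt.
apply/negP => Nlt.
have := build_prob_complete_le N p0 p1 (ltnW m3) k2m ls; rewrite -/x.
set L := ('C(m, 2) - _)%N in kP *; set e := _ + 2 in Nlt.
have p'0 := ltW p0.
(* By [matching_size], [e * x + L] is nonnegative, so the power of [p] is at most 1; and
   [A^-1 ^+ x <= A^-1] since [x > 0]. *)
have powN : N%:R ^+ x * p ^+ L <= A^-1 :> R.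
  apply: (@le_trans _ _ ((A^-1 * p `^ e) ^+ x * p ^+ L)).
    by rewrite ler_wpM2r ?exprn_ge0 // lerXn2r ?nnegrE ?mulr_ge0 ?invr_ge0 ?powR_ge0 //; lra.
  rewrite exprMn -(powR_mulrn _ (powR_ge0 _ _)) -powRrM -(powR_mulrn L p'0) -mulrA.
  rewrite -powRD ?(gt_eqF p0) ?implybT //.
  apply: (@le_trans _ _ (A^-1 ^+ 1 * 1)); last by rewrite mulr1.
  have iA : 0 <= A^-1 by rewrite invr_ge0; lra.
  rewrite ler_pM ?exprn_ge0 ?powR_ge0 //.
    by rewrite ler_wiXn2l // invf_le1; lra.
  rewrite -[leRHS](powRr0 p) ger_powR ?p0 ?(ltW p1) // /e.
  by move: kP; lra.
move=> bound; have := le_trans half bound; apply/negP; rewrite -ltNge.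
rewrite natrM -mulrA (natrX _ N).
apply: (@le_lt_trans _ _ (((x * 2) ^ m)%:R * A^-1)); first by rewrite ler_wpM2l.
have B0 : 0 < ((x * 2) ^ m)%:R :> R by rewrite ltr0n expn_gt0; lia.
by rewrite /A natrM invfM mulrCA divff ?gt_eqF // mulr1; lra.
Qed.
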